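(* Fix a main-layer channel gain realization $f=(f_1,\dots,f_L)\in\mathbb{C}^L$. The equation $$E\{\max\{R_m-\lambda,0\}\}=\frac{\lambda\tau}{Tp_r}$$ in the unknown $\lambda\ge0$ always has a solution, and the solution $\lambda^*$ is unique. The stopping rule $$M^*=\min\{m\ge1: R_m\ge\lambda^*\}$$ is an optimal sub-layer stopping rule, achieving the maximal sub-layer throughput $$\lambda^*=\sup_{M}\frac{E(Y_M)}{E(T_M)}=\frac{E(Y_{M^*})}{E(T_{M^*})},$$ where the supremum is over all sub-layer stopping rules $M$. (All expectations are conditional on $f$.)
   Context: Let $L\ge1$ be an integer (number of relays), $T,\tau,P_s,P_r,\sigma_g^2>0$ constants, $p_1\in(0,1)$, and $p_r=Lp_1(1-p_1)^{L-1}$. The vector $f=(f_1,\dots,f_L)$ consists of the fixed, already known (first-hop) channel gains from the transmitting source to the $L$ relays. Sub-layer observations are indexed by $m=1,2,\dots$. In observation $m$: the winning relay $s(m)$ is uniform on $\{1,\dots,L\}$; the number of contention slots $K_m$ is geometric, $\mathrm{Prob}(K_m=k)=p_r(1-p_r)^{k-1}$, $k\ge1$; the second-hop gains $g_1(m),\dots,g_L(m)$ from relays to the destination are (circularly symmetric) complex Gaussian with mean zero and variance $E|g_j(m)|^2=\sigma_g^2$. All these random variables are mutually independent, within and across observations. Put $$R_m=\log_2\left(1+\frac{P_sP_r|f_{s(m)}|^2|g_{s(m)}(m)|^2}{1+P_s|f_{s(m)}|^2+P_r|g_{s(m)}(m)|^2}\right),\quad Y_m=\tfrac T2R_m,\quad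 T_m=\tfrac T2+\tfrac\tau2\sum_{i=1}^mK_i.$$ A sub-layer stopping rule is a stopping time $M$ with values in $\{1,2,\dots\}$ with respect to the filtration generated by $(s(m),K_m,g_{s(m)}(m))$, $m\ge1$, with $E(T_M)<\infty$. *)

(* Defs.v *)
From HB Require Import structures.
From mathcomp Require Import all_boot all_order all_algebra.
From mathcomp Require Import all_classical all_reals all_analysis.
From mathcomp Require Export complex.
Import Order.TTheory GRing.Theory Num.Theory.
Import numFieldNormedType.Exports.

Set Implicit Arguments.
Unset Strict Implicit.
Unset Printing Implicit Defensive.

Local Open Scope classical_set_scope.
Local Open Scope ring_scope.

Definition log2 {R : realType} (x : R) : R := ln x / ln 2.

Definition borelC {R : realType} : set (set R[i]) :=
  preimage_set_system setT (fun z : R[i] => (complex.Re z, complex.Im z))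
    (@measurable _ (R * R)%type).

Section probability.
Context {R : realType} {d : measure_display} {Omega : measurableType d}.
Variable P : probability Omega R.

(* Mutual independence of the families of events [G i], [i] in [D]: the product
   rule holds for every finite duplicate-free list of indices from [D]. *)
Definition mutually_independent (I : eqType) (D : set I)
    (G : I -> set (set Omega)) : Prop :=
  forall (J : seq I) (A : I -> set Omega), uniq J ->
    (forall i, i \in J -> D i /\ G i (A i)) ->
    P (\bigcap_(i in [set` J]) A i) = (\prod_(i <- J) P (A i))%E.

(* Circularly symmetric complex Gaussian law of mean 0 and variance
   [v = E|Z|^2]: the real and imaginary parts are independent real normal
   variables of mean 0 and variance [v / 2].  The second argument of
   [normal_prob] is the standard deviation. *)
Definition complex_gaussian (v : R) (Z : Omega -> R[i]) : Prop :=
  forall A B : set R, measurable A -> measurable B ->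
    P [set w | A (complex.Re (Z w)) /\ B (complex.Im (Z w))] =
    (normal_prob 0 (Num.sqrt (v / 2)) A * normal_prob 0 (Num.sqrt (v / 2)) B)%E.

End probability.

Definition win_prob {R : realType} (L : nat) (p1 : R) : R :=
  L%:R * p1 * (1 - p1) ^+ L.-1.

(* Throughout, [s m w], [K m w] and [g j m w] are the winning relay, the number
   of contention slots and the second-hop gain of relay [j] in observation [m],
   at the sample point [w].  Observations are numbered from 1; the values at
   [m = 0] are never constrained nor used. *)
Section model.
Context {R : realType} {d : measure_display} {Omega : measurableType d}.
Context {L : nat}.
Variable P : probability Omega R.
Variables (T tau Ps Pr : R) (f : 'I_L -> R[i]).
Variables (s : nat -> Omega -> 'I_L) (K : nat -> Omega -> nat).
Variable g : 'I_L -> nat -> Omega -> R[i].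

Definition sigma_relay m : set (set Omega) :=
  preimage_set_system setT (s m) setT.
Definition sigma_slots m : set (set Omega) :=
  preimage_set_system setT (K m) setT.
Definition sigma_gain j m : set (set Omega) :=
  preimage_set_system setT (g j m) borelC.
Definition sigma_winner_gain m : set (set Omega) :=
  preimage_set_system setT (fun w => g (s m w) m w) borelC.

(* The random variables of the model: [inl (inl m)] stands for s(m),
   [inl (inr m)] for K_m and [inr (m, j)] for g_j(m). *)
Definition obs_var : eqType := (nat + nat + nat * 'I_L)%type.

Definition obs_number (x : obs_var) : nat :=
  match x with
  | inl (inl m) => m
  | inl (inr m) => m
  | inr (m, _) => m
  end.

Definition sigma_obs (x : obs_var) : set (set Omega) :=
  match x with
  | inl (inl m) => sigma_relay m
  | inl (inr m) => sigma_slots m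
  | inr (m, j) => sigma_gain j m
  end.

Record observation_model (pr sg2 : R) : Prop := ObservationModel {
  obs_measurable : forall x : obs_var, (1 <= obs_number x)%N ->
    sigma_obs x `<=` measurable ;
  relay_uniform : forall m (j : 'I_L), (1 <= m)%N ->
    P (s m @^-1` [set j]) = (L%:R^-1)%:E ;
  slots_geometric : forall m k, (1 <= m)%N -> (1 <= k)%N ->
    P (K m @^-1` [set k]) = (pr * (1 - pr) ^+ k.-1)%:E ;
  gain_gaussian : forall m j, (1 <= m)%N -> complex_gaussian P sg2 (g j m) ;
  obs_independent :
    mutually_independent P [set x : obs_var | (1 <= obs_number x)%N] sigma_obs
}.

Definition rate (m : nat) (w : Omega) : R :=
  let f2 := Normc.normc (f (s m w)) ^+ 2 in
  let g2 := Normc.normc (g (s m w) m w) ^+ 2 in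
  log2 (1 + (Ps * Pr * f2 * g2) / (1 + Ps * f2 + Pr * g2)).

Definition reward (m : nat) (w : Omega) : R := T / 2 * rate m w.

Definition elapsed (m : nat) (w : Omega) : R :=
  T / 2 + tau / 2 * \sum_(1 <= i < m.+1) (K i w)%:R.

Definition obs_filtration (m : nat) : set (set Omega) :=
  <<s \bigcup_(i in [set i | (1 <= i <= m)%N])
        (sigma_relay i `|` sigma_slots i `|` sigma_winner_gain i) >>.

(* A rule is a map [M : Omega -> option nat]; [M w = None] means that the rule
   never stops at [w], which a stopping rule may do only on a null event. *)
Definition stopped_reward (M : Omega -> option nat) (w : Omega) : R :=
  if M w is Some m then reward m w else 0.

Definition stopped_time (M : Omega -> option nat) (w : Omega) : \bar R :=
  if M w is Some m then (elapsed m w)%:E else +oo%E.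

Record stopping_rule (M : Omega -> option nat) : Prop := StoppingRule {
  stop_pos : forall w, M w <> Some 0%N ;
  stop_adapted : forall m, obs_filtration m [set w | M w = Some m] ;
  stop_ae : {ae P, forall w, M w <> None} ;
  stop_time_finite : (\int[P]_w stopped_time M w < +oo)%E
}.

Definition throughput (M : Omega -> option nat) : \bar R :=
  ('E_P[stopped_reward M] / \int[P]_w stopped_time M w)%E.

Definition threshold_rule (lam : R) (w : Omega) : option nat :=
  if pselect (exists m, (1 <= m)%N && (lam <= rate m w)) is left h
  then Some (ex_minn h) else None.

Definition threshold_equation (pr : R) (m : nat) (lam : R) : Prop :=
  ('E_P[fun w => (Num.max (rate m w - lam) 0)%R])%E = (lam * tau / (T * pr))%:E.

End model.

(* Main.v *)
(* Write W_i = max(R_i - l, 0), and let l be the root of E W_1 = l tau / (T p_r);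
   it exists and is unique because l |-> E W_1 is continuous, nonincreasing and
   vanishes once l exceeds a bound of the rates.  For any stopping rule M,
   R_M <= l + sum_(i <= M) W_i.  The event {i <= M} belongs to the past of
   observation i, hence is independent of R_i and K_i, and summing over i gives
   Wald's identities E sum_(i <= M) W_i = E W_1 * E M and
   E sum_(i <= M) K_i = E M / p_r.  By the choice of l the bound becomes
   E Y_M <= l * E T_M.  For the threshold rule, R_M >= l and W_i = 0 for i < M,
   so that equality holds. *)

Require Import Defs.
From HB Require Import structures.
From mathcomp Require Import all_boot all_order all_algebra.
From mathcomp Require Import all_classical all_reals all_analysis.
From mathcomp Require Import measurable_realfun ring.
Import Order.TTheory GRing.Theory Num.Theory.
Import numFieldNormedType.Exports.

Set Implicit Arguments.
Unset Strict Implicit.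
Unset Printing Implicit Defensive.

Local Open Scope classical_set_scope.
Local Open Scope ring_scope.

(** * Independence of blocks of variables *)

Section independence.
Local Open Scope ereal_scope.
Context {R : realType} {d : measure_display} {Omega : measurableType d}.
Variable P : probability Omega R.

(** The product rule of the model concerns the variables s(m), K_m and g_j(m), whereas the rates and
    the filtration involve the winner's gain g_{s(m)}(m), taken at a random index. Statements about
    it are obtained by splitting on the value of s(m): its events lie in the sigma-algebra of all
    variables of observation m, and the law of R_m is an average over j of laws that do not depend
    on m. A rule comes with no bound on E M. Stopped sums are therefore series of nonnegative terms
    in [\bar R], and both sides of Wald's identities may be infinite; finiteness of E T_M enters
    when the quotient is formed. That the threshold rule is admissible is a separate matter: all of
    the first m rates stay below l with probability q^m for some q < 1, so M* has a geometric tail,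
    which gives both almost sure stopping and E T_{M*} < oo. *)

Definition mass (A : set Omega) : {nonneg R} :=
  NngNum (fine_ge0 (measure_ge0 P A)).

Lemma mscale_mass (A X : set Omega) : measurable A ->
  mscale (mass A) P X = P A * P X.
Proof. by move=> mA; rewrite /mscale/= fineK// fin_num_measure. Qed.

(** As functions of [A], both sides are finite measures: the restriction of [P] to [B], and [P]
    scaled by [P B]. They agree on the pi-system [G] and have the same total mass, hence agree on
    [<<s G >>]. *)
Lemma g_sigma_algebra_indep (G : set (set Omega)) (B : set Omega) :
    setI_closed G -> G `<=` measurable -> measurable B ->
    (forall A, G A -> P (A `&` B) = P A * P B) ->
  forall A, <<s G >> A -> P (A `&` B) = P A * P B.
Proof.
move=> GI Gm mB GB.
have HG : [set X | G X /\ X `<=` setT] = G.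
  by apply/seteqP; split=> [X []|X GX]; last by split.
move=> A GA; rewrite [RHS]muleC -mscale_mass//.
have := @g_sigma_algebra_measure_unique_trace _ _ _ G setT _ _ _
  (mrestr P mB) (mscale (mass B) P).
rewrite HG; apply => //=.
- by rewrite mscale_mass//= /mrestr setTI probability_setT mule1.
- by move=> X GX; rewrite mscale_mass//= /mrestr muleC; exact: GB.
- by rewrite /mrestr setTI -ge0_fin_numE// fin_num_measure.
Qed.

Lemma integral_mrestr (A : set Omega) (mA : measurable A) (h : Omega -> \bar R) :
    measurable_fun setT h -> (forall w, 0 <= h w) ->
  \int[mrestr P mA]_w h w = \int[P]_(w in A) h w.
Proof.
move=> mh h0.
rewrite (@ge0_negligible_integral _ _ _ (mrestr P mA) setT (~` A))//; last 2 first.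
- exact: measurableC.
- by change (P (~` A `&` A) = 0); rewrite setICl measure0.
rewrite setTD setCK; apply: eq_measure_integral => X mX XA.
by change (P (X `&` A) = P X); rewrite setIidl.
Qed.

(** Both sides integrate [phi] against the same measure on [S]. A second variable [Y] allows the
    factor to refer to a fixed copy of [X], so that independence of [A] and equality of laws are
    used in one step. *)
Lemma integral_indep (d' : measure_display) (S : measurableType d')
    (X Y : Omega -> S) (A : set Omega) (phi : S -> \bar R) :
    measurable_fun setT X -> measurable_fun setT Y -> measurable A ->
    (forall U, measurable U -> P (A `&` X @^-1` U) = P A * P (Y @^-1` U)) ->
    measurable_fun setT phi -> (forall x, 0 <= phi x) ->
  \int[P]_(w in A) phi (X w) = P A * \int[P]_w phi (Y w).
Proof.
move=> mX mY mA XY mphi phi0.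
have mphiX : measurable_fun setT (phi \o X) by exact: measurableT_comp.
rewrite -(integral_mrestr mA mphiX); last by move=> w; exact: phi0.
rewrite -[LHS](@ge0_integral_pushforward _ _ _ _ _ _ mX _ setT)//.
rewrite -[X in _ = _ * X](@ge0_integral_pushforward _ _ _ _ _ _ mY _ setT)//.
rewrite -[P A]fineK ?fin_num_measure//.
rewrite -[fine _]/((mass A)%:num)%R -ge0_integral_mscale//.
apply: eq_measure_integral => U mU _.
transitivity (P (A `&` X @^-1` U)); first by rewrite setIC.
by rewrite XY//; exact/esym/(mscale_mass (Y @^-1` U) mA).
Qed.

(** * Sigma-algebras generated by disjoint groups of independent variables *)

Section cylinders.
Context {I : eqType} (G : I -> set (set Omega)).
Implicit Types D : set I.

(** Finite intersections form a pi-system, which the union of the families [G i] does not; they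
    generate the same sigma-algebra. *)
Definition cylinder D : set (set Omega) :=
  [set A | exists (J : seq I) (B : I -> set Omega), [/\ uniq J,
     forall i, i \in J -> D i /\ G i (B i) & A = \bigcap_(i in [set` J]) B i]].

Lemma cylinder_setI D : (forall i, sigma_algebra setT (G i)) ->
  setI_closed (cylinder D).
Proof.
move=> sG _ _ [J [B [uJ JB ->]]] [J' [B' [uJ' JB' ->]]].
(* Padding with [setT] writes both intersections over the merged list of indices. *)
pose C (K : seq I) (E : I -> set Omega) i := if i \in K then E i else setT.
exists (undup (J ++ J')), (fun i => C J B i `&` C J' B' i); split.
- exact: undup_uniq.
- move=> i; rewrite mem_undup mem_cat => iJJ'; split.
    by case/orP: iJJ' => [/JB[]|/JB'[]].
  have [[h0 hC hU] hI] : sigma_algebra setT (G i) /\ setI_closed (G i).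
    split; first exact: sG.
    by have /sigma_algebraP[] := sG i.
  have hT : G i setT by rewrite -[setT]setD0; exact: hC.
  apply: hI; rewrite /C; case: ifPn => // iK; first by case: (JB _ iK).
  by case: (JB' _ iK).
- apply/seteqP; split=> [w [wB wB'] i _|w wC].
    by split; rewrite /C; case: ifPn => // iK; [exact: wB|exact: wB'].
  split=> i iK.
    have [|+ _] := wC i; first by rewrite /= mem_undup mem_cat iK.
    by rewrite /C iK.
  have [|_] := wC i; first by rewrite /= mem_undup mem_cat iK orbT.
  by rewrite /C iK.
Qed.

Lemma sub_cylinder D i A : D i -> G i A -> cylinder D A.
Proof.
move=> Di GA; exists [:: i], (fun=> A); split=> //.
  by move=> j; rewrite inE => /eqP ->.
apply/seteqP; split=> [w wA j //|w wA].
by apply: (wA i); rewrite /= mem_seq1.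
Qed.

Lemma cylinder_measurable D : (forall i, D i -> G i `<=` measurable) ->
  cylinder D `<=` measurable.
Proof.
move=> Gm _ [J [B [uJ JB ->]]].
by apply: fin_bigcap_measurable => // i /JB[Di]; exact: Gm.
Qed.

(** Disjointness of [D1] and [D2] makes [J ++ J'] duplicate-free and lets [C] and [C'] be glued into
    one family [E]; the product rule for the concatenation then splits into the two products. *)
Lemma cylinder_indep D D1 D2 A B :
    mutually_independent P D G -> D1 `<=` D -> D2 `<=` D -> [disjoint D1 & D2] ->
  cylinder D1 A -> cylinder D2 B -> P (A `&` B) = P A * P B.
Proof.
move=> ind D1D D2D D12 [J [C [uJ JC ->]]] [J' [C' [uJ' JC' ->]]].
have dJ i : i \in J -> i \notin J'.
  move=> iJ; apply/negP => iJ'; have [D1i _] := JC _ iJ.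
  have [D2i _] := JC' _ iJ'; move/disj_setPS : D12 => /(_ i); exact.
pose E i := if i \in J then C i else C' i.
have CE : \bigcap_(i in [set` J]) C i = \bigcap_(i in [set` J]) E i.
  by apply: eq_bigcapr => i /= iJ; rewrite /E iJ.
have CE' : \bigcap_(i in [set` J']) C' i = \bigcap_(i in [set` J']) E i.
  apply: eq_bigcapr => i /= iJ'; rewrite /E ifN//.
  by apply: contraL iJ' => /dJ.
have JE i : i \in J -> D i /\ G i (E i).
  by move=> iJ; rewrite /E iJ; have [/D1D] := JC _ iJ.
have JE' i : i \in J' -> D i /\ G i (E i).
  move=> iJ'; rewrite /E ifN; first by have [/D2D] := JC' _ iJ'.
  by apply: contraL iJ' => /dJ.
rewrite CE CE' -bigcap_setU.
have -> : [set` J] `|` [set` J'] = [set` J ++ J'].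
  by apply/seteqP; split=> i /=; rewrite mem_cat => /orP.
rewrite !ind//; first by rewrite big_cat.
- rewrite cat_uniq uJ uJ' andbT/=; apply/hasPn => i iJ'.
  by apply: contraL iJ' => /dJ.
- by move=> i; rewrite mem_cat => /orP[/JE|/JE'].
Qed.

(** The pi-system argument is used twice: with [B] arbitrary it reduces [A] to a cylinder, and with
    [A] a cylinder it reduces [B] to one. *)
Lemma g_sigma_cylinder_indep D D1 D2 A B :
    (forall i, sigma_algebra setT (G i)) ->
    (forall i, D i -> G i `<=` measurable) ->
    mutually_independent P D G -> D1 `<=` D -> D2 `<=` D -> [disjoint D1 & D2] ->
  <<s cylinder D1 >> A -> <<s cylinder D2 >> B -> P (A `&` B) = P A * P B.
Proof.
move=> sG Gm ind D1D D2D D12 sA sB.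
have cm D' : D' `<=` D -> cylinder D' `<=` measurable.
  by move=> D'D; apply: cylinder_measurable => i /D'D; exact: Gm.
have sm D' : D' `<=` D -> <<s cylinder D' >> `<=` measurable.
  by move=> /cm; apply: smallest_sub; exact: sigma_algebra_measurable.
move: A sA; apply: (@g_sigma_algebra_indep (cylinder D1)).
- exact: cylinder_setI.
- exact: cm.
- exact: sm sB.
move=> A cA; rewrite setIC muleC.
move: B sB; apply: (@g_sigma_algebra_indep (cylinder D2)).
- exact: cylinder_setI.
- exact: cm.
- exact: cm cA.
move=> B cB; rewrite setIC muleC.
exact: (cylinder_indep ind D1D D2D).
Qed.

End cylinders.

End independence.

(** * Sums up to a stopping time *)

Section stopped_sums.
Local Open Scope ereal_scope.
Context {R : realType} {d : measure_display} {Omega : measurableType d}.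
Variable P : probability Omega R.
Variable M : Omega -> option nat.

(* [running m] is the event that the rule has not stopped by observation [m];
   it contains the points at which the rule never stops. *)
Definition running (m : nat) : set Omega :=
  [set w | forall i, (i <= m)%N -> M w <> Some i].

Lemma running_Some (w : Omega) (n m : nat) : M w = Some n ->
  running m w <-> (m < n)%N.
Proof.
move=> Mw; split=> [r|mn i im];
  last by rewrite Mw => -[ni]; rewrite -ni leqNgt mn in im.
by rewrite ltnNge; apply/negP => nm; exact: (r n).
Qed.

Lemma running_filtration (F : nat -> set (set Omega)) :
    (forall m, sigma_algebra setT (F m)) ->
    (forall m n, (m <= n)%N -> F m `<=` F n) ->
    (forall m, F m [set w | M w = Some m]) ->
  forall m, F m (running m).
Proof.
move=> sF ndF FM m; have [F0 FC FU] := sF m.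
(* Padding with [set0] turns a finite union into the countable union under which [F m] is closed. *)
pose A i := if (i <= m)%N then [set w | M w = Some i] else set0.
have -> : running m = setT `\` \bigcup_i A i.
  apply/seteqP; split=> [w rw|w [_ Aw] i im Mw].
    by split=> // -[i _]; rewrite /A; case: ifPn => // /rw.
  by apply: Aw; exists i => //; rewrite /A im.
by apply: FC; apply: FU => i; rewrite /A; case: ifPn => // /ndF; exact.
Qed.

Section series.
Variable u : nat -> Omega -> R.
Hypothesis u0 : forall i w, (0 <= u i w)%R.

(** The shift matters: [running m] is decided by the first [m] observations, so the indicator is
    independent of the summand from observation [m.+1]. *)
Definition stopped_sum (w : Omega) : \bar R :=
  \sum_(m <oo) (u m.+1 w * \1_(running m) w)%:E.

Lemma stopped_sum_Some (w : Omega) (n : nat) : M w = Some n ->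
  stopped_sum w = (\sum_(1 <= i < n.+1) u i w)%:E.
Proof.
move=> Mw; rewrite /stopped_sum (@nneseries_split _ _ 0 n); last first.
  by move=> k _; rewrite lee_fin mulr_ge0.
rewrite add0n [X in _ + X]eseries0 ?adde0; last first.
  move=> i ni _; rewrite indicE memNset ?mulr0// => /(running_Some _ Mw).
  by rewrite ltnNge ni.
rewrite sumEFin big_add1 /=; congr EFin; apply: eq_big_nat => i /andP[_ ni].
by rewrite indicE mem_set ?mulr1//; exact/(running_Some _ Mw).
Qed.

Lemma measurable_stopped_sum : (forall m, measurable (running m)) ->
    (forall m, measurable_fun setT (u m.+1)) ->
  measurable_fun setT stopped_sum.
Proof.
move=> mM mu; apply: ge0_emeasurable_sum => [m w _ _|m _].
  by rewrite lee_fin mulr_ge0.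
by apply/measurable_EFinP; apply: measurable_funM => //; exact: measurable_indic.
Qed.

Lemma stopped_sum_ge0 (w : Omega) : 0 <= stopped_sum w.
Proof. by apply: nneseries_ge0 => m _ _; rewrite lee_fin mulr_ge0. Qed.

(** Nonnegativity allows series and integral to be exchanged without any integrability. The last
    hypothesis is the form in which independence enters. For a rule that stops almost surely, the
    series of [P (running m)] is E M as a tail sum. *)
Lemma wald (a : R) : (forall m, measurable (running m)) ->
    (forall m, measurable_fun setT (u m.+1)) ->
    (forall m, \int[P]_(w in running m) (u m.+1 w)%:E = P (running m) * a%:E) ->
  \int[P]_w stopped_sum w = a%:E * \sum_(m <oo) P (running m).
Proof.
move=> mM mu ua; rewrite integral_nneseries//; last 2 first.
- move=> m; apply/measurable_EFinP.
  by apply: measurable_funM => //; exact: measurable_indic.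
- by move=> m w _; rewrite lee_fin mulr_ge0.
rewrite -nneseriesZl//; apply: eq_eseriesr => m _.
rewrite muleC -ua [RHS]integral_mkcond; apply: eq_integral => w _.
by rewrite patchE indicE; case: ifPn => wr; rewrite ?mulr1// ?mulr0.
Qed.

End series.

End stopped_sums.

(** * The observation model *)

Lemma expr_lt1_cvg0 (R : realType) (q : R) : 0 <= q -> q < 1 ->
  q ^+ n @[n --> \oo] --> (0 : R).
Proof. by move=> q0 q1; apply: cvg_expr; rewrite ger0_norm. Qed.

Lemma le0_of_le_expr (R : realType) (q x : R) : 0 <= q -> q < 1 ->
  (forall n, x <= q ^+ n) -> x <= 0.
Proof.
move=> q0 q1 xq; have cq := expr_lt1_cvg0 q0 q1.
rewrite -(cvg_lim _ cq)//; apply: limr_ge; first by apply/cvg_ex; exists 0.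
exact: nearW.
Qed.

Lemma geometric_eseries (R : realType) (q : R) : 0 <= q -> q < 1 ->
  (\sum_(n <oo) (q ^+ n)%:E = ((1 - q)^-1)%:E)%E.
Proof.
move=> q0 q1; apply/cvg_lim => //; rewrite -[(1 - q)^-1]mul1r.
have nq1 : `|q| < 1 by rewrite ger0_norm.
rewrite (_ : (fun n => _) = EFin \o series (geometric 1 q)).
  by apply: cvg_EFin; [exact: nearW|exact: cvg_geometric_series].
apply/funext => n; rewrite /= sumEFin; congr EFin.
by apply: eq_bigr => i _; rewrite /= mul1r.
Qed.

Lemma sigma_algebra_setT (S : Type) : sigma_algebra setT (@setT (set S)).
Proof. by []. Qed.

Lemma sigma_algebra_bigcup_fin (S : Type) (F : set (set S)) (n : nat)
    (A : 'I_n -> set S) : sigma_algebra setT F ->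
  (forall j, F (A j)) -> F (\bigcup_j A j).
Proof.
move=> [F0 _ FU] FA.
pose A' i := if insub i is Some j then A j else set0.
have -> : \bigcup_j A j = \bigcup_i A' i.
  apply/seteqP; split=> [w [j _ wj]|w [i _]].
    by exists (val j) => //; rewrite /A' valK.
  by rewrite /A'; case: insubP => // j _ _ wj; exists j.
by apply: FU => i; rewrite /A'; case: insub.
Qed.

Lemma sigma_algebra_borelC (R : realType) : sigma_algebra setT (@borelC R).
Proof. by apply: sigma_algebra_preimage; exact: sigma_algebra_measurable. Qed.

(** * Events on a variable selected by the winning relay *)

Section relay_mixture.
Context {R : realType} {d : measure_display} {Omega : measurableType d}.
Context {L : nat} (s : nat -> Omega -> 'I_L).

Definition parts (z : R[i]) : R * R := (complex.Re z, complex.Im z).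

(** On each event s(m) = j the index is deterministic, and there are finitely many j. The family [Z]
    serves two situations: all gains are available in [F] ([Z j] is g_j(m)), or only the winner's
    gain is ([Z j] is the same variable for all j). *)
Lemma relay_mixture_event (F : set (set Omega)) (m : nat)
    (Z : 'I_L -> Omega -> R[i]) (W : 'I_L -> set (R * R)) :
    sigma_algebra setT F -> sigma_relay s m `<=` F ->
    (forall j, preimage_set_system setT (Z j) borelC `<=` F) ->
    (forall j, measurable (W j)) ->
  F [set w | W (s m w) (parts (Z (s m w) w))].
Proof.
move=> sF Fs FZ mW.
have -> : [set w | W (s m w) (parts (Z (s m w) w))] =
    \bigcup_j (s m @^-1` [set j] `&` (parts \o Z j) @^-1` W j).
  by apply/seteqP; split=> [w Ww|w [j _ [/= <-]]//]; exists (s m w).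
apply: sigma_algebra_bigcup_fin => // j.
have /sigma_algebraP[//|_ _ _ FI] := sF; apply: FI.
  by apply: Fs; exists [set j] => //; rewrite setTI.
apply: FZ; exists (parts @^-1` W j); last by rewrite setTI.
by exists (W j) => //; rewrite setTI.
Qed.

End relay_mixture.

Section observations.
Context {R : realType} {d : measure_display} {Omega : measurableType d}.
Variables (P : probability Omega R) (L : nat) (pr sg2 : R).
Variables (s : nat -> Omega -> 'I_L) (K : nat -> Omega -> nat).
Variable g : 'I_L -> nat -> Omega -> R[i].
Hypothesis model : observation_model P s K g pr sg2.

Let positive : set (obs_var (L := L)) := [set x | (1 <= obs_number x)%N].
Let past m : set (obs_var (L := L)) := [set x | (1 <= obs_number x <= m)%N].
Let current m : set (obs_var (L := L)) := [set x | obs_number x = m].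

Definition block (D : set (obs_var (L := L))) : set (set Omega) :=
  <<s cylinder (sigma_obs s K g) D >>.

Lemma sigma_algebra_obs x : sigma_algebra setT (sigma_obs s K g x).
Proof.
case: x => [[m|m]|[m j]] /=; apply: sigma_algebra_preimage.
- exact: sigma_algebra_setT.
- exact: sigma_algebra_setT.
- exact: sigma_algebra_borelC.
Qed.

Lemma sub_block D x : D x -> sigma_obs s K g x `<=` block D.
Proof.
by move=> Dx A sA; apply: sub_sigma_algebra; exact: (sub_cylinder Dx).
Qed.

Lemma block_mixture D m W : (forall x, obs_number x = m -> D x) ->
    (forall j, measurable (W j)) ->
  block D [set w | W (s m w) (parts (g (s m w) m w))].
Proof.
move=> Dm mW; 
  apply: (@relay_mixture_event _ _ _ _ s (block D) m (fun j => g j m) W) => //.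
- exact: smallest_sigma_algebra.
- by apply: (@sub_block D (inl (inl m))); exact: Dm.
- by move=> j; apply: (@sub_block D (inr (m, j))); exact: Dm.
Qed.

(** The winner's gain is not one of the variables of the product rule. Enlarging the filtration to
    all past relays, slot counts and gains makes independence of the next observation available. *)
Lemma obs_filtration_block m : obs_filtration s K g m `<=` block (past m).
Proof.
apply: smallest_sub; first exact: smallest_sigma_algebra.
move=> A [i /= im [[]|]].
- by apply: (@sub_block _ (inl (inl i))).
- by apply: (@sub_block _ (inl (inr i))).
move=> [_ [V mV <-] <-]; rewrite !setTI.
by apply: (@block_mixture _ i (fun=> V)) => // x xi; rewrite /past/= xi.
Qed.

Lemma block_indep m A B : block (past m) A -> block (current m.+1) B ->
  P (A `&` B) = (P A * P B)%E.
Proof.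
apply: (@g_sigma_cylinder_indep _ _ _ _ _ _ positive).
- exact: sigma_algebra_obs.
- exact: obs_measurable model.
- exact: obs_independent model.
- by move=> x /andP[].
- by move=> x; rewrite /positive /current /= => ->.
- apply/disj_setPS => x [/andP[_ +]]; rewrite /current /= => xm xS.
  by rewrite xS ltnn in xm.
Qed.

Lemma block_measurable D : D `<=` positive -> block D `<=` measurable.
Proof.
move=> D0; apply: smallest_sub; first exact: sigma_algebra_measurable.
by apply: cylinder_measurable => x /D0 x0; exact: (obs_measurable model).
Qed.

Lemma sigma_algebra_filtration m : sigma_algebra setT (obs_filtration s K g m).
Proof. exact: smallest_sigma_algebra. Qed.

Lemma filtration_measurable m : obs_filtration s K g m `<=` measurable.
Proof.
apply: (subset_trans (@obs_filtration_block m)); apply: block_measurable.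
by move=> x /andP[].
Qed.

Lemma filtration_nondecreasing m n : (m <= n)%N ->
  obs_filtration s K g m `<=` obs_filtration s K g n.
Proof.
move=> mn; apply: sub_sigma_algebra2 => A [i /= /andP[i1 im] iA].
by exists i => //=; rewrite i1 (leq_trans im).
Qed.

(** * Boundedness, measurability and common law of the rates *)

Section rates.
Variables (Ps Pr : R) (f : 'I_L -> R[i]).
Hypotheses (Ps0 : 0 < Ps) (Pr0 : 0 < Pr).

Let power (j : 'I_L) : R := Normc.normc (f j) ^+ 2.

Definition gain_rate (j : 'I_L) (z : R * R) : R :=
  log2 (1 + (Ps * Pr * power j * (z.1 ^+ 2 + z.2 ^+ 2)) /
            (1 + Ps * power j + Pr * (z.1 ^+ 2 + z.2 ^+ 2))).

Let Ps_power_ge0 j : 0 <= Ps * power j.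
Proof. by apply: mulr_ge0; [exact: ltW|exact: sqr_ge0]. Qed.

Let gain_ge0 (z : R * R) : 0 <= Pr * (z.1 ^+ 2 + z.2 ^+ 2).
Proof. by apply: mulr_ge0; [exact: ltW|rewrite addr_ge0// sqr_ge0]. Qed.

Lemma rateE m w :
  rate Ps Pr f s g m w = gain_rate (s m w) (parts (g (s m w) m w)).
Proof.
rewrite /rate /gain_rate /power; case: (g _ m w) => a b /=.
by rewrite sqr_sqrtr ?addr_ge0 ?sqr_ge0.
Qed.

(** From 1 + ab/(1+a+b) = (1+a)(1+b)/(1+a+b). The difference of logarithms of polynomials makes
    measurability in [z] immediate. *)
Lemma gain_rateE j (z : R * R) : gain_rate j z =
  (ln ((1 + Ps * power j) * (1 + Pr * (z.1 ^+ 2 + z.2 ^+ 2))) -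
   ln (1 + Ps * power j + Pr * (z.1 ^+ 2 + z.2 ^+ 2))) / ln 2.
Proof.
have := Ps_power_ge0 j; have := gain_ge0 z; rewrite /gain_rate /log2.
move: (power j) (z.1 ^+ 2 + z.2 ^+ 2) => a b b0 a0.
have h0 : 0 < 1 + Ps * a + Pr * b by rewrite ltr_pwDl// ltr_pwDl.
rewrite -ln_div ?posrE// ?mulr_gt0 ?ltr_pwDl//; congr (ln _ / _).
have : 1 + Ps * a + Pr * b != 0 by rewrite gt_eqF.
by move=> ?; field.
Qed.

Lemma measurable_gain_rate j : measurable_fun setT (gain_rate j).
Proof.
have -> : gain_rate j = fun z =>
    (ln ((1 + Ps * power j) * (1 + Pr * (z.1 ^+ 2 + z.2 ^+ 2))) -
     ln (1 + Ps * power j + Pr * (z.1 ^+ 2 + z.2 ^+ 2))) / ln 2.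
  exact/funext/gain_rateE.
have mz : measurable_fun setT (fun z : R * R => Pr * (z.1 ^+ 2 + z.2 ^+ 2)).
  apply: measurable_funM => //; apply: measurable_funD.
    by apply: measurable_funX; exact: measurable_fst.
  by apply: measurable_funX; exact: measurable_snd.
apply: measurable_funM => //; apply: measurable_funB.
  apply: measurableT_comp; first exact: measurable_ln.
  by apply: measurable_funM => //; exact: measurable_funD.
apply: measurableT_comp; first exact: measurable_ln.
exact: measurable_funD.
Qed.

Lemma gain_rate_ge0 j z : 0 <= gain_rate j z.
Proof.
rewrite /gain_rate /log2 divr_ge0 ?ln_ge0 ?ler1n// lerDl divr_ge0//.
  by rewrite -mulrA mulrACA mulr_ge0// ?Ps_power_ge0// gain_ge0.
by rewrite !addr_ge0// ?Ps_power_ge0// gain_ge0.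
Qed.

(** Since ab/(1+a+b) <= a for a, b >= 0, the first hop alone bounds the rate, even though the
    Gaussian gain is unbounded. *)
Lemma gain_rate_le j z : gain_rate j z <= log2 (1 + Ps * power j).
Proof.
rewrite /gain_rate /log2 ler_pM2r ?invr_gt0 ?ln_gt0 ?ltr1n//.
have := Ps_power_ge0 j; have := gain_ge0 z.
move: (power j) (z.1 ^+ 2 + z.2 ^+ 2) => a b b0 a0.
have h0 : 0 < 1 + Ps * a + Pr * b by rewrite ltr_pwDl// ltr_pwDl.
rewrite ler_ln ?posrE ?lerD2l ?ltr_pwDl//; last first.
  by apply: divr_ge0; [rewrite -mulrA mulrACA mulr_ge0|exact: ltW].
rewrite ler_pdivrMr// !mulrDr mulr1 -subr_ge0.
have -> : Ps * a + Ps * a * (Ps * a) + Ps * a * (Pr * b) - Ps * Pr * a * b =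
  Ps * a * (1 + Ps * a) by ring.
by rewrite mulr_ge0// addr_ge0.
Qed.

Lemma rate_ge0 m w : 0 <= rate Ps Pr f s g m w.
Proof. by rewrite rateE; exact: gain_rate_ge0. Qed.

Lemma rate_bounded : exists C : R, forall m w, rate Ps Pr f s g m w <= C.
Proof.
(* The sum dominates each of its terms, all nonnegative, and so replaces a maximum over the
   relays. *)
exists (\sum_j log2 (1 + Ps * power j)) => m w; rewrite rateE.
rewrite (le_trans (gain_rate_le _ _))// (bigD1 (s m w))//= lerDl.
apply: sumr_ge0 => j _; exact: le_trans (gain_rate_ge0 j 0) (gain_rate_le j 0).
Qed.

Lemma rate_filtration m (U : set R) : (1 <= m)%N -> measurable U ->
  obs_filtration s K g m (rate Ps Pr f s g m @^-1` U).
Proof.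
move=> m1 mU.
have sub i : (1 <= i <= m)%N ->
    sigma_relay s i `|` sigma_slots K i `|` sigma_winner_gain s g i `<=`
    obs_filtration s K g m.
  by move=> im A sA; apply: sub_sigma_algebra; exists i.
rewrite (_ : _ @^-1` _ =
    [set w | (gain_rate (s m w) @^-1` U) (parts (g (s m w) m w))]); last first.
  by apply/seteqP; split=> w /=; rewrite rateE.
apply: (@relay_mixture_event _ _ _ _ s (obs_filtration s K g m) m
  (fun _ w => g (s m w) m w) (fun j => gain_rate j @^-1` U)).
- exact: sigma_algebra_filtration.
- by move=> A sA; apply: (sub m); [rewrite m1 /=|left; left].
- by move=> j A sA; apply: (sub m); [rewrite m1 /=|right].
- by move=> j; rewrite -[X in measurable X]setTI; exact: measurable_gain_rate.
Qed.

(** Counterpart of [rate_filtration]: that lemma makes the threshold rule adapted, this one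
    separates the rate from the past observations. *)
Lemma rate_block m (U : set R) : measurable U ->
  block (current m) (rate Ps Pr f s g m @^-1` U).
Proof.
move=> mU; rewrite (_ : _ @^-1` _ =
    [set w | (gain_rate (s m w) @^-1` U) (parts (g (s m w) m w))]); last first.
  by apply/seteqP; split=> w /=; rewrite rateE.
apply: (@block_mixture _ m (fun j => gain_rate j @^-1` U)) => // j.
by rewrite -[X in measurable X]setTI; exact: measurable_gain_rate.
Qed.

Lemma measurable_rate m : (1 <= m)%N ->
  measurable_fun setT (rate Ps Pr f s g m).
Proof.
move=> m1 _ U mU; rewrite setTI; apply: (@filtration_measurable m).
exact: rate_filtration.
Qed.

(** The Gaussian hypothesis gives the same probability to each rectangle for every [m], and
    rectangles are a pi-system generating the measurable sets of the plane. *)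
Lemma gain_law m j (V : set (R * R)) : (1 <= m)%N -> measurable V ->
  P ((parts \o g j m) @^-1` V) = P ((parts \o g j 1) @^-1` V).
Proof.
move=> m1 mV.
have mg i : (1 <= i)%N -> measurable_fun setT (parts \o g j i).
  move=> i1 _ U mU; rewrite setTI.
  apply: (obs_measurable model (x := inr (i, j))) => //=.
  by exists (parts @^-1` U); [exists U => //|]; rewrite setTI.
pose Z i (i1 : (1 <= i)%N) : {mfun Omega >-> (R * R)%type} :=
  HB.pack (parts \o g j i) (isMeasurableFun.Build _ _ _ _ _ (mg i i1)).
pose rect := [set A `*` B | A in @measurable _ R & B in @measurable _ R].
apply: (@measure_unique _ _ _ rect (fun=> setT) _ _ _ _
  (distribution P (Z m m1)) (distribution P (Z 1 isT))) => //.
- exact: measurable_prod_measurableType.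
- move=> _ _ [A mA [B mB <-]] [A' mA' [B' mB' <-]].
  exists (A `&` A'); first exact: measurableI.
  by exists (B `&` B'); [exact: measurableI|rewrite setXI].
- by move=> _; exists setT => //; exists setT => //; rewrite setXTT.
- by rewrite bigcup_const.
- move=> _ [A mA [B mB <-]].
  transitivity (P [set w | A (complex.Re (g j m w)) /\ B (complex.Im (g j m w))]).
    by [].
  rewrite (gain_gaussian model j m1 mA mB).
  by rewrite -(gain_gaussian model j (leqnn 1) mA mB).
- by move=> _; rewrite -ge0_fin_numE// fin_num_measure.
Qed.

(** Splitting on the winner and using the independence of s(m) and g_j(m) gives the uniform average
    over j of the laws of [gain_rate j] at g_j(1), an expression free of [m]. *)
Lemma rate_law m (U : set R) : (1 <= m)%N -> measurable U ->
  P (rate Ps Pr f s g m @^-1` U) = P (rate Ps Pr f s g 1 @^-1` U).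
Proof.
suff H : forall m, (1 <= m)%N -> measurable U ->
    P (rate Ps Pr f s g m @^-1` U) =
    (\sum_(j \in [set: 'I_L]) (L%:R^-1)%:E *
      P ((parts \o g j 1) @^-1` (gain_rate j @^-1` U)))%E.
  by move=> m1 mU; rewrite !H.
move=> {}m m1 mU.
have mW j : measurable (gain_rate j @^-1` U).
  by rewrite -[X in measurable X]setTI; exact: measurable_gain_rate.
have -> : rate Ps Pr f s g m @^-1` U = \bigcup_j
    (s m @^-1` [set j] `&` (parts \o g j m) @^-1` (gain_rate j @^-1` U)).
  apply/seteqP; split=> w /=; rewrite rateE; first by exists (s m w).
  by move=> [j _ [/= <-]].
have srelay j : sigma_relay s m (s m @^-1` [set j]).
  by exists [set j] => //; rewrite setTI.
have sgain j : sigma_gain g j m ((parts \o g j m) @^-1` (gain_rate j @^-1` U)).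
  exists (parts @^-1` (gain_rate j @^-1` U)); last by rewrite setTI.
  by exists (gain_rate j @^-1` U); rewrite ?setTI.
rewrite measure_fin_bigcup//.
- apply: eq_fsbigr => j _.
  rewrite -(relay_uniform model j m1) -(gain_law j m1 (mW j)).
  apply: (@cylinder_indep _ _ _ _ _ (sigma_obs s K g) positive
      [set inl (inl m)] [set inr (m, j)]).
  + exact: (obs_independent model).
  + by move=> _ ->.
  + by move=> _ ->.
  + by apply/disj_setPS => x [/= ->].
  + exact: (@sub_cylinder _ _ _ (sigma_obs s K g) _ (inl (inl m)) _ erefl
      (srelay j)).
  + exact: (@sub_cylinder _ _ _ (sigma_obs s K g) _ (inr (m, j)) _ erefl
      (sgain j)).
- exact: finite_finset.
- by move=> i j _ _ [w [[/= <- _] [/= <- _]]].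
- move=> j _; apply: measurableI.
    exact: (obs_measurable model (x := inl (inl m)) m1 (srelay j)).
  exact: (obs_measurable model (x := inr (m, j)) m1 (sgain j)).
Qed.

Lemma integral_rate m (A : set Omega) (phi : R -> \bar R) :
    obs_filtration s K g m A ->
    measurable_fun setT phi -> (forall x, 0 <= phi x)%E ->
  (\int[P]_(w in A) phi (rate Ps Pr f s g m.+1 w) =
   P A * \int[P]_w phi (rate Ps Pr f s g 1 w))%E.
Proof.
move=> FA mphi phi0; apply: integral_indep => //.
- exact: measurable_rate.
- exact: measurable_rate.
- exact: filtration_measurable FA.
move=> U mU; rewrite (@block_indep m).
- by rewrite rate_law.
- exact: obs_filtration_block.
- exact: rate_block.
Qed.

End rates.

(** * Tail and mean of the number of contention slots *)

Section slots.
Hypothesis pr0 : 0 < pr.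

Let measurable_slots m (U : set nat) : (1 <= m)%N -> measurable (K m @^-1` U).
Proof.
move=> m1; apply: (obs_measurable model (x := inl (inr m)) m1).
by exists U => //; rewrite setTI.
Qed.

Let pr_le1 : pr <= 1.
Proof.
(* [pr] is rewritten as the probability that K_1 equals 1. *)
rewrite -lee_fin -[pr]mulr1 -[X in (pr * X)%R](expr0 (1 - pr)).
rewrite -(slots_geometric model (leqnn 1) (leqnn 1)).
exact/probability_le1/measurable_slots.
Qed.

Lemma slots_prefix m n : (1 <= m)%N ->
  P (K m @^-1` [set k | (1 <= k <= n)%N]) = (1 - (1 - pr) ^+ n)%:E.
Proof.
move=> m1; elim: n => [|n IH].
  rewrite (_ : _ @^-1` _ = set0) ?measure0 ?expr0 ?subrr//.
  by apply/seteqP; split=> w //=; rewrite leqn0 => /andP[/lt0n_neq0/negbTE ->].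
have -> : K m @^-1` [set k | (1 <= k <= n.+1)%N] =
    K m @^-1` [set k | (1 <= k <= n)%N] `|` K m @^-1` [set n.+1].
  apply/seteqP; split=> w /=; last first.
    by case=> [/andP[-> kn]|->]; rewrite ?(leq_trans kn)// leqnn.
  by case/andP=> k1; rewrite leq_eqVlt ltnS => /orP[/eqP|kn];
    [right|left; rewrite k1].
rewrite measureU; [|exact: measurable_slots|exact: measurable_slots|]; last first.
  by apply/seteqP; split=> w //= [/andP[_ +] kn]; rewrite kn ltnn.
rewrite (_ : 1 - _ = 1 - (1 - pr) ^+ n + pr * (1 - pr) ^+ n).
  by rewrite EFinD; congr (_ + _)%E; [exact: IH|exact: (slots_geometric model)].
by rewrite exprS; ring.
Qed.

(** The geometric law is prescribed for k >= 1, so K_m = 0 must first be shown to be null.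
    Complements of prefixes give P(K_m = 0) + P(K_m > i) = (1 - pr)^i for every i, which bounds
    P(K_m = 0) by arbitrarily small powers. *)
Lemma slots_tail m n : (1 <= m)%N ->
  P (K m @^-1` [set k | (n < k)%N]) = ((1 - pr) ^+ n)%:E.
Proof.
move=> m1.
have complement i :
    (P (K m @^-1` [set 0%N]) + P (K m @^-1` [set k | (i < k)%N]) =
    ((1 - pr) ^+ i)%:E)%E.
  rewrite -measureU; [|exact: measurable_slots|exact: measurable_slots|]; last first.
    by apply/seteqP; split=> w //= [-> ].
  have -> : K m @^-1` [set 0%N] `|` K m @^-1` [set k | (i < k)%N] =
      ~` (K m @^-1` [set k | (1 <= k <= i)%N]).
    apply/seteqP; split=> w /=; first case=> [-> //|ik].
      by case/andP=> _; rewrite leqNgt ik.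
    case: (K m w) => [|k] kn; [by left|right].
    by rewrite ltnNge; apply/negP => ki; exact: kn.
  transitivity (P (~` (K m @^-1` [set k | (1 <= k <= i)%N]))); first by [].
  rewrite probability_setC; last exact: measurable_slots.
  by rewrite slots_prefix// -EFinB subKr.
suff -> : ((1 - pr) ^+ n)%:E = (0 + P (K m @^-1` [set k | (n < k)%N]))%E.
  by rewrite add0e.
rewrite -complement; congr (_ + _)%E.
apply/eqP; rewrite eq_le measure_ge0 andbT.
have p0fin : P (K m @^-1` [set 0%N]) \is a fin_num.
  by apply: fin_num_measure; exact: measurable_slots.
rewrite -(fineK p0fin) lee_fin.
have q0 : 0 <= 1 - pr by rewrite subr_ge0.
have q1 : 1 - pr < 1 by rewrite ltrBlDr ltrDl.
apply: (le0_of_le_expr q0 q1) => i.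
by rewrite -lee_fin fineK// -complement leeDl.
Qed.

Lemma expectation_slots m : (1 <= m)%N ->
  (\int[P]_w (K m w)%:R%:E = (pr^-1)%:E)%E.
Proof.
move=> m1; pose M w := Some (K m w).
(* [K m] is the sum of [K m] ones, and the tail sum formula is Wald's identity
   for the rule stopping at [K m]. *)
have runE n : running M n = K m @^-1` [set k | (n < k)%N].
  by apply/seteqP; split=> w; move/(running_Some n (erefl (M w))).
have mrun n : measurable (running M n) by rewrite runE; exact: measurable_slots.
transitivity (\int[P]_w stopped_sum M (fun _ _ => 1%R) w)%E.
  apply: eq_integral => w _; rewrite (@stopped_sum_Some _ _ _ _ _ _ _ (K m w))//.
  by rewrite sumr_const_nat subSS subn0.
rewrite (@wald _ _ _ P M _ _ 1)//; last first.
  by move=> n; rewrite integral_cst// mul1e mule1.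
rewrite mul1e.
under eq_eseriesr do rewrite runE slots_tail//.
by rewrite geometric_eseries ?subKr// ?subr_ge0// ltrBlDr ltrDl.
Qed.

Lemma integral_slots m (A : set Omega) : obs_filtration s K g m A ->
  (\int[P]_(w in A) (K m.+1 w)%:R%:E = P A * (pr^-1)%:E)%E.
Proof.
move=> FA; rewrite -(expectation_slots (ltn0Sn m)).
have mK : measurable_fun setT (K m.+1).
  move=> _ U mU; rewrite setTI; exact: (measurable_slots U (ltn0Sn m)).
apply: (@integral_indep _ _ _ P _ _ (K m.+1) (K m.+1) A (fun k => k%:R%:E)) => //.
- exact: filtration_measurable FA.
- move=> U mU; apply: block_indep; first exact: (obs_filtration_block FA).
  apply: (@sub_block _ (inl (inr m.+1))) => //.
  by exists U => //; rewrite setTI.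
Qed.

Lemma measurable_slotsR m : (1 <= m)%N ->
  measurable_fun setT (fun w => (K m w)%:R : R).
Proof.
move=> m1 _ U mU; rewrite setTI.
exact: (measurable_slots (m := m) ((fun k => k%:R) @^-1` U)).
Qed.

End slots.

End observations.

(** * The threshold equation *)

Lemma lipschitz_continuous (R : realType) (F : R -> R) (c : R) : 0 < c ->
  (forall x y, `|F x - F y| <= c * `|x - y|) -> continuous F.
Proof.
move=> c0 FL x; apply/cvgrPdist_lt => eps eps0; near=> y.
rewrite (le_lt_trans (FL x y))// -ltr_pdivlMl//.
by near: y; apply: cvgr_dist_lt; [exact: cvg_id|rewrite mulr_gt0// invr_gt0].
Unshelve. all: by end_near. Qed.

Section excess.
Context {R : realType} {d : measure_display} {Omega : measurableType d}.
Variables (P : probability Omega R) (X : Omega -> R).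
Hypothesis mX : measurable_fun setT X.

Definition excess (l : R) : \bar R := (\int[P]_w (Num.max (X w - l) 0)%:E)%E.

Lemma measurable_excess l :
  measurable_fun setT (fun w => (Num.max (X w - l) 0)%:E).
Proof.
apply/measurable_EFinP; apply: measurable_maxr => //.
exact: measurable_funB.
Qed.

Let pos_ge0 (x : R) : (0 <= (Num.max x 0)%:E)%E.
Proof. by rewrite lee_fin le_max lexx orbT. Qed.

Lemma excess_ge0 l : (0 <= excess l)%E.
Proof. by apply: integral_ge0 => w _. Qed.

Lemma excess_nonincreasing l l' : l <= l' -> (excess l' <= excess l)%E.
Proof.
move=> ll'; apply: ge0_le_integral => // [||w _]; [exact: measurable_excess..|].
by rewrite lee_fin; apply: le_max2; rewrite // lerD2l lerN2.
Qed.

(** The additive form makes sense before [excess] is known to be finite; finiteness is then deduced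
    from it by taking [l'] equal to the bound [C], where the excess vanishes. *)
Lemma excess_lipschitz l l' : (excess l <= excess l' + `|l - l'|%:E)%E.
Proof.
have cstE : (\int[P]_w (`|l - l'|%:E) = `|l - l'|%:E)%E.
  by rewrite integral_cst// [X in (_ * X)%E]probability_setT mule1.
rewrite -{}cstE -ge0_integralD//; last exact: measurable_excess.
apply: ge0_le_integral => // [||w _]; first exact: measurable_excess.
  by apply: emeasurable_funD => //; exact: measurable_excess.
rewrite -EFinD lee_fin ge_max; apply/andP; split; last first.
  by rewrite addr_ge0// le_max lexx orbT.
rewrite (@le_trans _ _ ((X w - l') + `|l - l'|))//; last first.
  by rewrite lerD2r le_max lexx.
by rewrite -addrA lerD2l -lerBlDl opprK addrC distrC ler_norm.
Qed.

Variable C : R.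
Hypothesis XC : forall w, X w <= C.

Lemma excess_bound l : C <= l -> excess l = 0%E.
Proof.
move=> Cl; apply: integral0_eq => w _; congr EFin.
by apply/max_idPr; rewrite subr_le0 (le_trans (XC w)).
Qed.

Lemma excess_fin_num l : excess l \is a fin_num.
Proof.
rewrite ge0_fin_numE ?excess_ge0//.
by rewrite (le_lt_trans (excess_lipschitz l C))// excess_bound// add0e ltry.
Qed.

Lemma excess_root (k : R) : 0 < k ->
  exists2 lam, 0 <= lam & excess lam = (lam * k)%:E.
Proof.
move=> k0; pose F l := fine (excess l) - l * k.
have FE l : F l = 0 -> excess l = (l * k)%:E.
  by move=> /eqP; rewrite subr_eq0 => /eqP <-; rewrite fineK// excess_fin_num.
have F0 : 0 <= F 0 by rewrite /F mul0r subr0 fine_ge0// excess_ge0.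
(* The excess vanishes from [C] on; the maximum keeps the interval from 0 to [D] nonempty when [C]
   is negative. *)
pose D := Num.max C 0.
have D0 : 0 <= D by rewrite le_max lexx orbT.
have FD : F D <= 0.
  by rewrite /F excess_bound ?le_max ?lexx// sub0r oppr_le0 mulr_ge0// ltW.
have FL x y : `|F x - F y| <= (1 + k) * `|x - y|.
  have eL a b : fine (excess a) - fine (excess b) <= `|a - b|.
    rewrite lerBlDl -lee_fin EFinD !fineK ?excess_fin_num//.
    exact: excess_lipschitz.
  have -> : F x - F y = (fine (excess x) - fine (excess y)) - k * (x - y).
    by rewrite /F; ring.
  rewrite (le_trans (ler_normB _ _))// mulrDl mul1r lerD//.
    by rewrite ler_norml eL lerNl opprB distrC eL.
  by rewrite normrM gtr0_norm.
have [] := @IVT _ F 0 D 0 D0.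
- by apply: continuous_subspaceT; apply: lipschitz_continuous FL; rewrite addr_gt0.
- by rewrite ge_min le_max FD F0 orbT.
move=> lam; rewrite in_itv/= => /andP[lam0 _] /FE; by exists lam.
Qed.

(** A nonincreasing function meets the strictly increasing [l * k] at most once. *)
Lemma excess_root_unique (k l l' : R) : 0 < k ->
  excess l = (l * k)%:E -> excess l' = (l' * k)%:E -> l = l'.
Proof.
move=> k0.
wlog ll' : l l' / l <= l'.
  by move=> W; have [/W//|/ltW/W W'] := leP l l'; move=> ? ?; exact/esym/W'.
move=> el el'; apply/eqP; rewrite eq_le ll'/= -(ler_pM2r k0) -lee_fin -el -el'.
exact: excess_nonincreasing.
Qed.

End excess.

(** * Upper bound on the throughput *)

(** The preimage is cut along the countable partition by the value of [M]. Excluding the value 0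
    restricts the pieces to successors, since nothing is assumed about [u 0]. *)
Lemma measurable_stopped (d d' : measure_display) (Omega : measurableType d)
    (S : measurableType d') (M : Omega -> option nat)
    (u : nat -> Omega -> S) (c : S) :
    (forall w, M w <> Some 0%N) ->
    (forall m, measurable [set w | M w = Some m]) ->
    (forall m, measurable_fun setT (u m.+1)) ->
  measurable_fun setT (fun w => if M w is Some m then u m w else c).
Proof.
move=> M0 mM mu _ U mU; rewrite setTI.
pose E m := [set w | M w = Some m].
have -> : (fun w => if M w is Some m then u m w else c) @^-1` U =
    (\bigcup_m (E m.+1 `&` u m.+1 @^-1` U)) `|`
    (~` (\bigcup_m E m) `&` cst c @^-1` U).
  apply/seteqP; split=> w /=.
    case Mw: (M w) => [[|m]|] Uw; first by have := M0 w.
      by left; exists m.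
    by right; split=> // -[m _]; rewrite /E /= Mw.
  case=> [[m _ [/= -> //]]|[nE Uc]]; case Mw: (M w) => [m|//].
  by exfalso; apply: nE; exists m.
apply: measurableU.
  apply: bigcupT_measurable => m; apply: measurableI; first exact: mM.
  by rewrite -[X in measurable X]setTI; exact: mu.
apply: measurableI.
  by apply: measurableC; exact: bigcupT_measurable.
by rewrite preimage_cst; case: ifP.
Qed.

Section stopping.
Context {R : realType} {d : measure_display} {Omega : measurableType d}.
Variables (P : probability Omega R) (L : nat) (T tau Ps Pr pr sg2 : R).
Variables (f : 'I_L -> R[i]) (s : nat -> Omega -> 'I_L).
Variables (K : nat -> Omega -> nat) (g : 'I_L -> nat -> Omega -> R[i]).
Hypothesis model : observation_model P s K g pr sg2.
Hypotheses (T0 : 0 < T) (tau0 : 0 < tau) (Ps0 : 0 < Ps) (Pr0 : 0 < Pr).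
Hypothesis pr0 : 0 < pr.

Local Notation rt := (rate Ps Pr f s g).

(** * Wald's identities and the reward bound for an arbitrary rule *)

Section rule.
Variable M : Omega -> option nat.
Hypothesis M_pos : forall w, M w <> Some 0%N.
Hypothesis M_adapted : forall m, obs_filtration s K g m [set w | M w = Some m].
Hypothesis M_ae : {ae P, forall w, M w <> None}.

(** The expected number of observations E M, possibly infinite. *)
Let S : \bar R := (\sum_(m <oo) P (running M m))%E.

Let S0 : (0 <= S)%E.
Proof. exact: nneseries_ge0. Qed.

Let running_adapted m : obs_filtration s K g m (running M m).
Proof.
apply: running_filtration => //; first exact: sigma_algebra_filtration.
by move=> i j; exact: filtration_nondecreasing.
Qed.

Let mrunning m : measurable (running M m).
Proof. by apply: (filtration_measurable model); exact: running_adapted. Qed.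

Let mM m : measurable [set w | M w = Some m].
Proof. by apply: (filtration_measurable model); exact: M_adapted. Qed.

Let half_T0 : 0 <= T / 2.
Proof. by rewrite divr_ge0// ltW. Qed.

Let half_tau0 : 0 <= tau / 2.
Proof. by rewrite divr_ge0// ltW. Qed.

Lemma measurable_stopped_time : measurable_fun setT (stopped_time T tau K M).
Proof.
apply: (measurable_stopped (u := fun m w => (elapsed T tau K m w)%:E)) => // m.
apply/measurable_EFinP; apply: measurable_funD => //; apply: measurable_funM => //.
under eq_fun do rewrite big_add1/=.
by apply: measurable_sum => i; exact: (measurable_slotsR model (ltn0Sn i)).
Qed.

Lemma elapsed_ge m w : T / 2 <= elapsed T tau K m w.
Proof. by rewrite lerDl mulr_ge0// sumr_ge0. Qed.

Lemma stopped_time_ge w : ((T / 2)%:E <= stopped_time T tau K M w)%E.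
Proof.
by rewrite /stopped_time; case: (M w) => [m|]; rewrite ?leey// lee_fin elapsed_ge.
Qed.

Lemma stopped_time_ge0 w : (0 <= stopped_time T tau K M w)%E.
Proof. by apply: le_trans (stopped_time_ge w); rewrite lee_fin. Qed.

Lemma integral_stopped_time :
  (\int[P]_w stopped_time T tau K M w =
   (T / 2)%:E + (tau / 2 / pr)%:E * S)%E.
Proof.
pose N := stopped_sum M (fun i w => (K i w)%:R : R).
have mK m : measurable_fun setT (fun w => (K m.+1 w)%:R : R).
  exact: (measurable_slotsR model (ltn0Sn m)).
have mN : measurable_fun setT N by apply: measurable_stopped_sum.
have -> : (\int[P]_w stopped_time T tau K M w =
    \int[P]_w ((T / 2)%:E + (tau / 2)%:E * N w))%E.
  (* Equality is claimed almost everywhere only: where the rule never stops, [stopped_time] is [+oo]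
     by convention, while [N] is the full series of slot counts. *)
  apply: ge0_ae_eq_integral => //.
  - exact: measurable_stopped_time.
  - by apply: emeasurable_funD => //; exact: measurable_funeM.
  - by move=> w _; exact: stopped_time_ge0.
  - move=> w _; rewrite adde_ge0 ?lee_fin// mule_ge0 ?lee_fin//.
    exact: stopped_sum_ge0.
  - apply: filterS M_ae => w Mw _; rewrite /stopped_time.
    case Mn : (M w) => [n|//]; rewrite /N (stopped_sum_Some _ Mn)//.
rewrite ge0_integralD//; last 2 first.
- by move=> w _; rewrite mule_ge0 ?lee_fin//; exact: stopped_sum_ge0.
- exact: measurable_funeM.
rewrite integral_cst// [X in (_ * X + _)%E]probability_setT mule1.
rewrite ge0_integralZl//; last by move=> w _; exact: stopped_sum_ge0.
rewrite (@wald _ _ _ _ _ _ _ (pr^-1))//; first by rewrite muleA -EFinM.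
by move=> m; exact: (integral_slots model).
Qed.

Variable l : R.
Hypotheses (l0 : 0 <= l)
  (l_root : excess P (rt 1) l = (l * (tau / (T * pr)))%:E).

Let W (i : nat) (w : Omega) : R := Num.max (rt i w - l) 0.

Let W0 i w : 0 <= W i w.
Proof. by rewrite /W le_max lexx orbT. Qed.

Definition reward_bound (w : Omega) : \bar R :=
  ((T / 2)%:E * (l%:E + stopped_sum M W w))%E.

Let mW m : measurable_fun setT (W m.+1).
Proof.
by apply/measurable_EFinP/measurable_excess; exact: (measurable_rate model).
Qed.

Lemma measurable_reward_bound : measurable_fun setT reward_bound.
Proof.
apply: measurable_funeM; apply: emeasurable_funD => //.
exact: measurable_stopped_sum.
Qed.

Lemma reward_bound_ge0 w : (0 <= reward_bound w)%E.
Proof.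
rewrite mule_ge0 ?lee_fin// adde_ge0 ?lee_fin//; exact: stopped_sum_ge0.
Qed.

(** Both sides are affine in [S]. The constant terms agree, and the coefficients of [S] agree
    precisely by the choice of [l]. As this is an equality for every rule, any loss of throughput
    comes from the pointwise bound on the reward. *)
Lemma integral_reward_bound :
  (\int[P]_w reward_bound w = l%:E * \int[P]_w stopped_time T tau K M w)%E.
Proof.
have mS := measurable_stopped_sum W0 mrunning mW.
rewrite ge0_integralZl//; last 2 first.
- exact: emeasurable_funD.
- by move=> w _; rewrite adde_ge0 ?lee_fin//; exact: stopped_sum_ge0.
rewrite ge0_integralD//; last by move=> w _; exact: stopped_sum_ge0.
rewrite integral_cst// [X in (_ * (_ * X + _))%E]probability_setT mule1.
rewrite (@wald _ _ _ _ _ _ _ (l * (tau / (T * pr))))//; last first.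
  move=> m; rewrite -l_root.
  apply: (integral_rate model f Ps0 Pr0
    (phi := fun x => (Num.max (x - l) 0)%:E)) => //.
    exact: (measurable_excess (@measurable_id _ _ setT)).
  by move=> x; rewrite lee_fin le_max lexx orbT.
rewrite integral_stopped_time -/S.
have [T_ge0 tau_ge0 pr_ge0] : [/\ 0 <= T, 0 <= tau & 0 <= pr].
  by split; exact: ltW.
rewrite !ge0_muleDr ?lee_fin// ?mule_ge0 ?lee_fin ?mulr_ge0 ?invr_ge0//
  ?mulr_ge0//.
rewrite !muleA -!EFinM; congr (_%:E + _%:E * _)%E; first by rewrite mulrC.
by field; rewrite !gt_eqF.
Qed.

Lemma stopped_reward_le w :
  ((stopped_reward T Ps Pr f s g M w)%:E <= reward_bound w)%E.
Proof.
rewrite /stopped_reward; case Mn : (M w) => [n|]; last exact: reward_bound_ge0.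
rewrite /reward_bound (stopped_sum_Some _ Mn)//.
case: n => [|n] in Mn *; first by have := M_pos Mn.
rewrite -EFinD -EFinM lee_fin ler_wpM2l// -lerBlDl.
rewrite big_nat_recr//= ler_wpDl ?sumr_ge0//.
by rewrite /W le_max lexx.
Qed.

Lemma measurable_stopped_reward :
  measurable_fun setT (fun w => (stopped_reward T Ps Pr f s g M w)%:E).
Proof.
apply/measurable_EFinP.
apply: (measurable_stopped (u := reward T Ps Pr f s g)) => // m.
by apply: measurable_funM => //; exact: (measurable_rate model).
Qed.

Lemma stopped_reward_ge0 w : 0 <= stopped_reward T Ps Pr f s g M w.
Proof.
rewrite /stopped_reward; case: (M w) => // n.
by rewrite mulr_ge0//; exact: rate_ge0.
Qed.

Lemma expectation_stopped_reward_le :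
  ('E_P[stopped_reward T Ps Pr f s g M] <=
   l%:E * \int[P]_w stopped_time T tau K M w)%E.
Proof.
rewrite unlock -integral_reward_bound; apply: ge0_le_integral => //.
- by move=> w _; rewrite lee_fin stopped_reward_ge0.
- exact: measurable_stopped_reward.
- exact: measurable_reward_bound.
- by move=> w _; exact: stopped_reward_le.
Qed.

Lemma expectation_stopped_reward_eq :
    (forall w n, M w = Some n -> l <= rt n w /\
       (forall i, (1 <= i < n)%N -> rt i w < l)) ->
  ('E_P[stopped_reward T Ps Pr f s g M] =
   l%:E * \int[P]_w stopped_time T tau K M w)%E.
Proof.
move=> Ml; rewrite unlock -integral_reward_bound; apply: ge0_ae_eq_integral => //.
- exact: measurable_stopped_reward.
- exact: measurable_reward_bound.
- by move=> w _; rewrite lee_fin stopped_reward_ge0.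
- by move=> w _; exact: reward_bound_ge0.
apply: filterS M_ae => w Mw _; rewrite /stopped_reward.
case Mn : (M w) => [n|//]; rewrite /reward_bound (stopped_sum_Some _ Mn)//.
case: n => [|n] in Mn *; first by have := M_pos Mn.
have [ln li] := Ml _ _ Mn.
rewrite -EFinD -EFinM; congr (_ * _)%:E.
rewrite big_nat_recr//= big_nat big1 ?add0r; last first.
  by move=> i /li /ltW il; apply/max_idPr; rewrite subr_le0.
by rewrite /W; move: ln; rewrite -subr_ge0 => /max_idPl ->; rewrite subrKC.
Qed.

End rule.

End stopping.

(** * The threshold rule *)

Section threshold.
Context {R : realType} {d : measure_display} {Omega : measurableType d}.
Variables (P : probability Omega R) (L : nat) (T tau Ps Pr pr sg2 : R).
Variables (f : 'I_L -> R[i]) (s : nat -> Omega -> 'I_L).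
Variables (K : nat -> Omega -> nat) (g : 'I_L -> nat -> Omega -> R[i]).
Hypothesis model : observation_model P s K g pr sg2.
Hypotheses (T0 : 0 < T) (tau0 : 0 < tau) (Ps0 : 0 < Ps) (Pr0 : 0 < Pr).
Hypothesis pr0 : 0 < pr.

Local Notation rt := (rate Ps Pr f s g).

(** The rates share one law, so one root serves all observations. The law is transferred by
    [integral_rate] on the whole space, which belongs to every filtration. *)
Lemma threshold_equationE m l : (1 <= m)%N ->
  threshold_equation P T tau Ps Pr f s g pr m l <->
  excess P (rt 1) l = (l * (tau / (T * pr)))%:E.
Proof.
case: m => // m _; rewrite /threshold_equation unlock -mulrA.
suff -> : (\int[P]_w (Num.max (rt m.+1 w - l) 0)%:E = excess P (rt 1) l)%E by [].
rewrite (integral_rate model f Ps0 Pr0 (phi := fun x => (Num.max (x - l) 0)%:E)).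
- by rewrite probability_setT mul1e.
- have [F0 FC _] := sigma_algebra_filtration s K g m.
  by rewrite -[setT]setD0; exact: FC.
- exact: (measurable_excess (@measurable_id _ _ setT)).
- by move=> x; rewrite lee_fin le_max lexx orbT.
Qed.

Variable l : R.

Local Notation Mstar := (threshold_rule Ps Pr f s g l).

Lemma threshold_ruleP w n : Mstar w = Some n <->
  [/\ (1 <= n)%N, l <= rt n w & forall i, (1 <= i < n)%N -> rt i w < l].
Proof.
rewrite /threshold_rule; case: pselect => [h|h]; last first.
  by split=> // -[n1 ln _]; exfalso; apply: h; exists n; rewrite n1.
case: ex_minnP => m /andP[m1 lm] mmin.
have below_m i : (1 <= i < m)%N -> rt i w < l.
  move=> /andP[i1 im]; rewrite ltNge; apply/negP => li.
  by have := mmin i; rewrite i1 li leqNgt im => /(_ isT).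
split=> [[<-]//|[n1 ln below_n]]; congr Some.
apply/eqP; rewrite eqn_leq mmin ?n1//= leqNgt; apply/negP => mn.
by have := below_n m; rewrite m1 mn ltNge lm => /(_ isT).
Qed.

Definition below m : set Omega :=
  [set w | forall i, (1 <= i <= m)%N -> rt i w < l].

(** This describes survival of the rule by the rates, whose joint probability factorizes; points
    where the rule never stops belong to both sides. *)
Lemma running_threshold m : running Mstar m = below m.
Proof.
apply/seteqP; split=> [w rw i /andP[i1 im]|w bw i im /threshold_ruleP[i1 li _]].
  rewrite ltNge; apply/negP => li.
  case Mw : (Mstar w) => [n|]; last first.
    move: Mw; rewrite /threshold_rule; case: pselect => // h _.
    by apply: h; exists i; rewrite i1.
  have /threshold_ruleP[_ _ below_n] := Mw.
  apply: (rw n) => //; rewrite leqNgt; apply/negP => mn.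
  by have := below_n i; rewrite i1 (leq_ltn_trans im mn) ltNge li => /(_ isT).
by have := bw i; rewrite i1 im ltNge li => /(_ isT).
Qed.

Lemma belowS m : below m.+1 = below m `&` rt m.+1 @^-1` `]-oo, l[.
Proof.
apply/seteqP; split=> [w bw|w [bw /=]].
  split=> [i /andP[i1 im]|/=]; first by apply: bw; rewrite i1 (leq_trans im).
  by rewrite in_itv/=; apply: bw; rewrite leqnn.
rewrite in_itv/= => lm i /andP[i1]; rewrite leq_eqVlt => /orP[/eqP ->//|im].
by apply: bw; rewrite i1.
Qed.

Lemma filtrationI m A B : obs_filtration s K g m A -> obs_filtration s K g m B ->
  obs_filtration s K g m (A `&` B).
Proof.
by move: A B; have /sigma_algebraP[] := sigma_algebra_filtration s K g m.
Qed.

Lemma below_filtration m : obs_filtration s K g m (below m).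
Proof.
elim: m => [|m IH].
  have -> : below 0 = setT by apply/seteqP; split=> // w _ [|i].
  have [F0 FC _] := sigma_algebra_filtration s K g 0.
  by rewrite -[setT]setD0; exact: FC.
rewrite belowS; apply: filtrationI;
  first exact: (filtration_nondecreasing (leqnSn m) IH).
exact: rate_filtration.
Qed.

Lemma threshold_adapted m : obs_filtration s K g m [set w | Mstar w = Some m].
Proof.
case: m => [|m].
  have -> : [set w | Mstar w = Some 0%N] = set0.
    by apply/seteqP; split=> w //= /threshold_ruleP[].
  by have [] := sigma_algebra_filtration s K g 0.
have -> : [set w | Mstar w = Some m.+1] = below m `&` rt m.+1 @^-1` `[l, +oo[.
  apply/seteqP; split=> w /=.
    by case/threshold_ruleP => _ lm b; rewrite in_itv/= lm.
  by rewrite in_itv/= andbT => -[b lm]; apply/threshold_ruleP.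
apply: filtrationI; last exact: rate_filtration.
by apply: (filtration_nondecreasing (leqnSn m)); exact: below_filtration.
Qed.

Let q := fine (P (rt 1 @^-1` `]-oo, l[)).

(** At each step the event [below m] belongs to the past and the next rate to the current block,
    with the law of the first rate. *)
Lemma below_prob m : P (below m) = (q ^+ m)%:E.
Proof.
elim: m => [|m IH].
  have -> : below 0 = setT by apply/seteqP; split=> // w _ [|i].
  exact: probability_setT.
rewrite belowS (block_indep model (m := m)).
- rewrite (rate_law model f Ps0 Pr0)// IH exprSr EFinM fineK// fin_num_measure//.
  rewrite -[X in measurable X]setTI.
  exact: (measurable_rate model f Ps0 Pr0 (leqnn 1)).
- by apply: obs_filtration_block; exact: below_filtration.
- exact: rate_block.
Qed.

Hypotheses (l0 : 0 <= l)
  (l_root : excess P (rt 1) l = (l * (tau / (T * pr)))%:E).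

(* If the rate were almost surely below [l], then E W_1 = 0, so [l = 0] by the
   threshold equation, and no rate is negative. *)
Lemma prob_below_lt1 : q < 1.
Proof.
have mr := measurable_rate model f Ps0 Pr0 (leqnn 1).
have mb : measurable (rt 1 @^-1` `]-oo, l[).
  by rewrite -[X in measurable X]setTI; exact: mr.
have qE : P (rt 1 @^-1` `]-oo, l[) = q%:E by rewrite fineK// fin_num_measure.
rewrite lt_neqAle -lee_fin -qE probability_le1// andbT.
apply/negP => /eqP q1.
have Pa : P (~` (rt 1 @^-1` `]-oo, l[)) = 0%E.
  by rewrite probability_setC// qE q1 subee.
have l_eq0 : l = 0.
  have : excess P (rt 1) l = 0%E.
    rewrite /excess (ge0_negligible_integral (N := ~` (rt 1 @^-1` `]-oo, l[)))//.
    - apply: integral0_eq => w; rewrite setTD setCK /= in_itv/= => /ltW wl.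
      by congr EFin; apply/max_idPr; rewrite subr_le0.
    - exact: measurableC.
    - exact: measurable_excess.
    - by move=> w _; rewrite lee_fin le_max lexx orbT.
  rewrite l_root => -[] /eqP; rewrite mulf_eq0 => /orP[/eqP//|].
  by rewrite gt_eqF// divr_gt0// mulr_gt0.
have b0 : rt 1 @^-1` `]-oo, l[ = set0.
  apply/seteqP; split=> w //=; rewrite in_itv/= l_eq0 ltNge.
  by rewrite rate_ge0.
by move: qE; rewrite b0 measure0 q1 => -[] /eqP; rewrite eq_sym oner_eq0.
Qed.

Let q0 : 0 <= q. Proof. exact: fine_ge0. Qed.

(** Never stopping means lying in every [below m], an event of probability at most q^m for all m. *)
Lemma threshold_ae : {ae P, forall w, Mstar w <> None}.
Proof.
pose E := \bigcap_m below m.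
have mb m : measurable (below m).
  by apply: (filtration_measurable model); exact: below_filtration.
have mE : measurable E by exact: bigcap_measurable.
exists E; split=> //; last first.
  move=> w /contrapT Mw m _; rewrite -running_threshold => i _.
  by rewrite Mw.
apply/eqP; rewrite eq_le measure_ge0 andbT.
have Efin : P E \is a fin_num by rewrite fin_num_measure.
rewrite -(fineK Efin) lee_fin.
apply: (le0_of_le_expr q0 prob_below_lt1) => m.
rewrite -lee_fin fineK// -below_prob le_measure ?inE//.
exact: bigcap_inf.
Qed.

Lemma threshold_stopping_rule : stopping_rule P T tau s K g Mstar.
Proof.
have Mpos w : Mstar w <> Some 0%N by move=> /threshold_ruleP[].
split=> //; [exact: threshold_adapted|exact: threshold_ae|].
rewrite (integral_stopped_time model)//; 
  [|exact: threshold_adapted|exact: threshold_ae].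
(* The number of observations is geometric with success probability [1 - q], so its mean is
   finite. *)
have -> : (\sum_(m <oo) P (running Mstar m) = ((1 - q)^-1)%:E)%E.
  under eq_eseriesr do rewrite running_threshold below_prob.
  exact: geometric_eseries q0 prob_below_lt1.
by rewrite -EFinM -EFinD ltry.
Qed.

Lemma expectation_threshold_reward :
  ('E_P[stopped_reward T Ps Pr f s g Mstar] =
   l%:E * \int[P]_w stopped_time T tau K Mstar w)%E.
Proof.
apply: (expectation_stopped_reward_eq model) => //.
- by move=> w /threshold_ruleP[].
- exact: threshold_adapted.
- exact: threshold_ae.
- by move=> w n /threshold_ruleP[].
Qed.

End threshold.

Lemma win_prob_gt0 (R : realType) (L : nat) (p : R) : (1 <= L)%N ->
  0 < p < 1 -> 0 < win_prob L p.
Proof.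
move=> L1 /andP[p0 p1].
by rewrite /win_prob !mulr_gt0 ?ltr0n// exprn_gt0// subr_gt0.
Qed.

Theorem theorem3 (R : realType) (d : measure_display) (Omega : measurableType d)
    (P : probability Omega R) (L : nat) (T tau Ps Pr sg2 p1 : R)
    (f : 'I_L -> R[i]) (s : nat -> Omega -> 'I_L) (K : nat -> Omega -> nat)
    (g : 'I_L -> nat -> Omega -> R[i])
    (hL : (1 <= L)%N) (hT : 0 < T) (htau : 0 < tau) (hPs : 0 < Ps)
    (hPr : 0 < Pr) (hsg2 : 0 < sg2) (hp1 : 0 < p1 < 1)
    (hmodel : observation_model P s K g (win_prob L p1) sg2) :
  exists lam : R,
    let Mstar := threshold_rule Ps Pr f s g lam in
    [/\ forall m, (1 <= m)%N ->
          unique (fun l : R => 0 <= l /\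
            threshold_equation P T tau Ps Pr f s g (win_prob L p1) m l) lam,
        stopping_rule P T tau s K g Mstar,
        lam%:E = ereal_sup [set throughput P T tau Ps Pr f s K g M |
                              M in [set M | stopping_rule P T tau s K g M]]
      & lam%:E = throughput P T tau Ps Pr f s K g Mstar].
Proof.
have pr0 := win_prob_gt0 hL hp1.
have mr := measurable_rate hmodel f hPs hPr (leqnn 1).
have [C rC] := rate_bounded s g f hPs hPr.
have k0 : 0 < tau / (T * win_prob L p1) by rewrite divr_gt0// mulr_gt0.
have [lam lam0 lam_root] := excess_root P mr (rC 1) k0.
have rule := threshold_stopping_rule hmodel hT htau hPs hPr pr0 lam_root.
(* Division in [\bar R] is handled through a positive real denominator: positivity comes from E T_M
   >= T/2, finiteness from the definition of a stopping rule. *)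
have time M : stopping_rule P T tau s K g M -> exists2 t, 0 < t &
    (\int[P]_w stopped_time T tau K M w = t%:E)%E.
  move=> [M0 Mad Mae Mfin].
  have T2 : 0 < T / 2 by rewrite divr_gt0.
  have lower : ((T / 2)%:E <= \int[P]_w stopped_time T tau K M w)%E.
    rewrite (integral_stopped_time hmodel)// leeDl// mule_ge0//.
      by rewrite lee_fin !divr_ge0// ltW.
    exact: nneseries_ge0.
  have tfin : (\int[P]_w stopped_time T tau K M w)%E \is a fin_num.
    by rewrite ge0_fin_numE// (le_trans _ lower)// lee_fin ltW.
  exists (fine (\int[P]_w stopped_time T tau K M w)%E).
    by rewrite -lte_fin fineK// (lt_le_trans _ lower).
  by rewrite fineK.
pose Mstar := threshold_rule Ps Pr f s g lam.
have tp_eq : throughput P T tau Ps Pr f s K g Mstar = lam%:E.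
  have [t t0 tE] := time _ rule.
  rewrite /throughput tE.
  rewrite (expectation_threshold_reward hmodel hT htau hPs hPr pr0 lam0 lam_root) tE.
  by rewrite inver gt_eqF// -!EFinM mulfK// gt_eqF.
exists lam; split => //.
- move=> m m1; split.
    by split=> //; apply/(threshold_equationE T tau f hmodel hPs hPr).
  move=> l [l0 /(threshold_equationE T tau f hmodel hPs hPr _ m1) l_root].
  exact: (excess_root_unique mr k0 lam_root l_root).
- apply/eqP; rewrite eq_le; apply/andP; split.
    by rewrite -tp_eq; apply: ereal_sup_ubound; exists Mstar.
  apply: ge_ereal_sup => _ [M ruleM <-].
  have [t t0 tE] := time _ ruleM; have [M0 Mad Mae Mfin] := ruleM.
  rewrite /throughput tE inver gt_eqF// lee_pdivrMr// -tE.
  exact: (expectation_stopped_reward_le hmodel).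
Qed.
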